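(* Let $\{X_\alpha : \alpha\in A\}$ be a family of $\omega$-bounded-pracompact topological spaces. Then the product $X=\prod_{\alpha\in A}X_\alpha$ (with the Tychonoff product topology) is $\omega$-bounded-pracompact. Moreover, if all spaces $X_\alpha$ are $T_1$, then every $\Sigma$-product of the family $\{X_\alpha : \alpha\in A\}$ is $\omega$-bounded-pracompact too.
   Context: A topological space $X$ is $\omega$-bounded-pracompact if it contains a dense subset $D$ such that each countable subset of $D$ has compact closure in $X$. Here ''compact'' means that each open cover has a finite subcover (no separation axiom is included). Let $X=\prod_{\alpha\in A}X_\alpha$. A $\Sigma$-product of the family $\{X_\alpha\}$ is a subspace $Y\subset X$ (with the subspace topology) for which there exists a point $y=(y_\alpha)\in X$ such that $Y=\{x\in X : x_\alpha=y_\alpha \text{ for all but countably many } \alpha\in A\}$. *)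

(* Defs.v *)
From HB Require Import structures.
From mathcomp Require Import all_boot all_order all_algebra.
From mathcomp Require Import all_classical all_reals all_analysis.

Set Implicit Arguments.
Unset Strict Implicit.
Unset Printing Implicit Defensive.

Local Open Scope classical_set_scope.

(* [cover_compact] is the open-cover definition of compactness; no separation
   axiom is involved. *)
Definition omega_bounded_pracompact (X : topologicalType) : Prop :=
  exists D : set X, dense D /\
    forall C : set X, C `<=` D -> countable C -> cover_compact (closure C).

(* A Sigma-product is a subset of the product; coercing it to [set_type]
   equips it with the subspace topology. *)
Definition is_Sigma_product (A : Type) (X : A -> topologicalType)
    (Y : set (prod_topology X)) : Prop :=
  exists y : prod_topology X,
    Y = [set x | countable [set a | x a <> y a]].

(* Main.v *)
Require Import Defs.
From HB Require Import structures.
From mathcomp Require Import all_boot all_order all_algebra finmap.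
From mathcomp Require Import all_classical all_reals all_analysis.

Set Implicit Arguments.
Unset Strict Implicit.

Local Open Scope classical_set_scope.

(* Take [D] to be the points all of whose coordinates lie in the given dense
   sets [D_a]; compactness of closures comes from Tychonoff's theorem.  For the
   Sigma-product around [y], first add [y_a] to [D_a]: as points are closed,
   countable subsets of the enlarged set still have compact closure.  Points of
   [D] differing from [y] at finitely many coordinates are already dense, and
   the closure of a countable subset [C] of the Sigma-product stays inside it:
   outside a countable set of coordinates all of [C] agrees with [y]. *)

(** [compact_cover] is about pointed spaces; a point of [K] makes [T] pointed, and empty [K] is
    treated apart. *)
Lemma cover_compactP (T : topologicalType) (K : set T) :
  cover_compact K <-> compact K.
Proof.
have [K0|] := pselect (K !=set0); last first.
  move=> /nonemptyPn ->; split=> _; first exact: compact0.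
  by move=> I D f _ _; exists fset0%fset.
have [x _] := K0.
pose pT := isPointed.Build T x.
pose T' : ptopologicalType := HB.pack T pT.
by rewrite -[cover_compact K]/(@cover_compact T' K) -(@compact_cover T').
Qed.

(* The boxes form a filter, so it suffices to see that this filter converges
   to [x] coordinatewise. *)
Lemma nbhs_prod_topology_box (A : Type) (X : A -> topologicalType)
    (x : prod_topology X) (U : set (prod_topology X)) :
  nbhs x U -> exists (F : set A) (V : forall a, set (X a)),
    [/\ finite_set F, forall a, nbhs (x a) (V a) &
        [set z | forall a, F a -> V a (z a)] `<=` U].
Proof.
pose G : set_system (prod_topology X) := [set W |
  exists (F : set A) (V : forall a, set (X a)),
    [/\ finite_set F, forall a, nbhs (x a) (V a) &
        [set z | forall a, F a -> V a (z a)] `<=` W]].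
have FG : Filter G.
  split.
  - by exists set0, (fun=> setT); split=> // a; exact: filterT.
  - move=> P Q [F [V [fF nV VP]]] [F' [V' [fF' nV' VQ]]].
    exists (F `|` F'), (fun a => V a `&` V' a); split.
    + by rewrite finite_setU.
    + by move=> a; exact: filterI.
    + move=> z VV'z; split.
        by apply: VP => a Fa; apply: (VV'z a (or_introl Fa)).1.
      by apply: VQ => a Fa; apply: (VV'z a (or_intror Fa)).2.
  - by move=> P Q PQ [F [V [fF nV VP]]]; exists F, V; split=> // z /VP /PQ.
suff : G --> x by move=> Gx /Gx.
apply/cvg_sup => i W [_ [] [B oB <-] Bxi BW].
(* A subbasic neighbourhood is a box restricting the single coordinate [i]. *)
pose V := @dfwith {classic A} (fun a => set (X a)) (fun=> setT) i B.
have Vi : V i = B by exact: dfwithin.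
exists [set i], V; split; first exact: finite_set1.
  move=> a; rewrite /V; case: (@dfwithP {classic A}) => [|j _]; last first.
    exact: filterT.
  exact: open_nbhs_nbhs.
by move=> z Vz; apply: BW; rewrite /= -Vi; exact: Vz.
Qed.

(** A basic box restricts only finitely many coordinates: there density supplies a point of [D a] in
    the box, and elsewhere [y a] is kept. *)
Lemma dense_finite_support (A : Type) (X : A -> topologicalType)
    (D : forall a, set (X a)) (y : prod_topology X) :
  (forall a, dense (D a)) -> (forall a, D a (y a)) ->
  dense [set z : prod_topology X |
    (forall a, D a (z a)) /\ finite_set [set a | z a <> y a]].
Proof.
move=> dD Dy O [x Ox] oO.
have [F [V [fF nV VO]]] := nbhs_prod_topology_box (open_nbhs_nbhs (conj oO Ox)).
pose z : prod_topology X := fun a =>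
  if `[< F a >] then xget (y a) (V a `&` D a) else y a.
have VDz a : F a -> (V a `&` D a) (z a).
  move=> Fa; rewrite /z; case: asboolP => // _.
  have [B [oB Bx] BV] : exists2 B, open_nbhs (x a) B & B `<=` V a.
    by have := nV a; rewrite nbhsE.
  have [t [Bt Dt]] : B `&` D a !=set0 by apply: dD => //; exists (x a).
  by apply: (@xgetI _ _ _ t); split=> //; exact: BV.
exists z; split; first by apply: VO => a /VDz [].
split=> [a|].
  have [/VDz [] //|nFa] := pselect (F a).
  by rewrite /z; case: asboolP.
apply: sub_finite_set fF => a; rewrite /= /z; case: asboolP => //.
Qed.

Lemma closure_proj (A : Type) (X : A -> topologicalType)
    (C : set (prod_topology X)) z a :
  closure C z -> closure ((fun x => x a) @` C) (z a).
Proof.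
move=> clz W /(@proj_continuous {classic A} X a z) /clz [c [Cc Wc]].
by exists (c a); split=> //; exists c.
Qed.

(** [closure C] is a closed subset of the product of the closures of the projections of [C], which
    is compact by Tychonoff. *)
Lemma compact_closure_prod (A : Type) (X : A -> topologicalType)
    (C : set (prod_topology X)) :
  (forall a, compact (closure ((fun x => x a) @` C))) -> compact (closure C).
Proof.
move=> cC; apply: (@subclosed_compact _ _ _ _ (@tychonoff {classic A} X _ cC)).
  exact: closed_closure.
by move=> z clz a; exact: closure_proj.
Qed.

Lemma closureU1_compact (T : topologicalType) (D C : set T) (y : T) :
  accessible_space T ->
  (forall B, B `<=` D -> countable B -> compact (closure B)) ->
  C `<=` D `|` [set y] -> countable C -> compact (closure C).
Proof.
move=> T1 cD CD cC.
apply: (@subclosed_compact _ _ (closure (C `&` D) `|` [set y])).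
- exact: closed_closure.
- apply: compactU; last exact: compact_set1.
  apply: cD; first by move=> ? [].
  exact: sub_countable (subset_card_le (@subIsetl _ _ _)) cC.
- rewrite [X in _ `|` X](iffLR (closure_id [set y])); last first.
    exact: accessible_closed_set1.
  rewrite -closureU; apply: closureS => t Ct.
  by have [Dt|] := CD t Ct; [left|right].
Qed.

(** A filter on [Y] is pushed forward to [T]; its cluster point there lies in [Y] and lifts to a
    cluster point of the original filter. *)
Lemma compact_closure_set_type (T : topologicalType) (Y : set T) (B : set Y) :
  compact (closure (set_val @` B)) -> closure (set_val @` B) `<=` Y ->
  compact (closure B).
Proof.
move=> cB BY F PF FB.
have val_cont : continuous (set_val : Y -> T) by exact: initial_continuous.
have [|p [clBp clFp]] := cB (fmap set_val F) _.
  apply: (@filterS _ F _ (closure B)) FB => q clBq W nW.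
  have [b [Bb Wb]] := clBq _ (val_cont q W nW).
  by exists (set_val b); split=> //; exists b.
pose q : Y := exist _ p (mem_set (BY _ clBp)).
have clFq : cluster F q.
  move=> P Q FP [_ [[W oW <-] Wq] WQ].
  have nW : nbhs p W by exact: open_nbhs_nbhs.
  have [|_ [[t Pt <-] Wt]] := clFp (set_val @` P) W _ nW.
    by apply: (@filterS _ F _ P) FP => t Pt; exists t.
  by exists t; split=> //; exact: WQ.
exists q; split=> //.
(* A cluster point lies in the closure of every member of [F], in particular of the closed set
   [closure B]. *)
move: clFq; rewrite clusterE => /(_ _ FB).
by rewrite -(closure_id _).1 //; exact: closed_closure.
Qed.

Theorem proposition2p4 (A : Type) (X : A -> topologicalType)
    (hX : forall a, omega_bounded_pracompact (X a)) :
  omega_bounded_pracompact (prod_topology X) /\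
  ((forall a, accessible_space (X a)) ->
   forall Y : set (prod_topology X), is_Sigma_product Y ->
     omega_bounded_pracompact (set_type Y)).
Proof.
pose D a := projT1 (cid (hX a)).
have dD a : dense (D a) by rewrite /D; case: cid => ? [].
have cD a (B : set (X a)) : B `<=` D a -> countable B -> compact (closure B).
  rewrite /D; case: cid => Da [_ cDa] /= BD Bc; apply/cover_compactP.
  exact: cDa.
split.
  exists [set z | forall a, D a (z a)]; split.
    move=> O [x Ox] oO.
    (* Some factor may be empty, so the base point [y] can be chosen only once a point [x] of the
       product is at hand. *)
    have D0 a : D a !=set0.
      have [||t []] := dD a setT; [by exists (x a)|exact: openT|by exists t].
    pose y : prod_topology X := fun a => projT1 (cid (D0 a)).
    have Dy a : D a (y a) by rewrite /y; case: cid.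
    have [|//|z [Oz [Dz _]]] := dense_finite_support dD Dy (O := O).
      by exists x.
    by exists z.
  move=> C CD cC; apply/cover_compactP/compact_closure_prod => a; apply: cD.
    by move=> _ [c Cc <-]; exact: CD.
  exact: sub_countable (card_image_le _ _) cC.
move=> T1 _ [y ->].
set Y := [set x : prod_topology X | countable [set a | x a <> y a]].
pose D' a := D a `|` [set y a].
have dD' a : dense (D' a).
  move=> O O0 oO; have [t [Ot Dt]] := dD a O O0 oO.
  by exists t; split=> //; left.
have Dy a : D' a (y a) by right.
exists [set z : Y | forall a, D' a (set_val z a)]; split.
  move=> O [x Ox] [W oW WO].
  have [|//|z [Wz [Dz fz]]] := dense_finite_support dD' Dy (O := W).
    by exists (set_val x); rewrite -WO in Ox.
  (* Finitely many differences from [y] keep [z] inside the Sigma-product. *)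
  have Yz : Y z by exact: finite_set_countable.
  by exists (exist _ z (mem_set Yz)); split=> //; rewrite -WO.
move=> C CD cC; apply/cover_compactP.
have cC' : countable (set_val @` C) := sub_countable (card_image_le _ _) cC.
apply: compact_closure_set_type.
  apply: compact_closure_prod => a.
  apply: closureU1_compact (T1 a) (cD a) _ _.
    by move=> _ [_ [c Cc <-] <-]; exact: CD.
  exact: sub_countable (card_image_le _ _) cC'.
move=> z clz.
suff : [set a | z a <> y a] `<=`
    \bigcup_(c in set_val @` C) [set a | c a <> y a].
  move=> /subset_card_le/sub_countable; apply; apply: bigcup_countable => //.
  by move=> _ [c _ <-]; exact: (set_mem (svalP c)).
move=> a /= zya; apply: contrapT => nC; apply: zya.
(* No point of [C] differs from [y] at [a], so [C] projects into [[set y a]], which is closed; hence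
   [z a = y a]. *)
have : closure [set y a] (z a).
  move: (@closure_proj _ _ _ _ a clz); apply: closureS => _ [c Cc <-] /=.
  by apply: contrapT => cya; apply: nC; exists c.
by rewrite -(closure_id _).1//; exact: accessible_closed_set1.
Qed.
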